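(* Let $Q$ be a subdirectly irreducible medial quandle. Then $Q$ falls within one of the following four disjoint classes: \begin{itemize} \item $Q$ is latin (a finite or infinite cancellative Alexander quandle); \item $Q$ is connected, infinite and quasi-reductive (a non-cancellative Alexander quandle); \item $Q$ is reductive (finite or infinite); \item $Q$ is non-connected, infinite and quasi-reductive, but not reductive. \end{itemize}
   Context: A quandle is an algebra $(Q,\ast,\backslash)$ with two binary operations such that for all $x,y,z\in Q$: $x\ast x=x$; $x\ast(y\ast z)=(x\ast y)\ast(x\ast z)$; $x\backslash(x\ast y)=y=x\ast(x\backslash y)$. It is medial if for all $x,y,u,v$: $(x\ast y)\ast(u\ast v)=(x\ast u)\ast(y\ast v)$, $(x\backslash y)\backslash(u\backslash v)=(x\backslash u)\backslash(y\backslash v)$ and $(x\backslash y)\ast(u\backslash v)=(x\ast u)\backslash(y\ast v)$. Let $L_a\colon x\mapsto a\ast x$ and $R_a\colon x\mapsto x\ast a$. A quandle is latin if every $R_a$ is a bijection. The orbits of $Q$ are the orbits of the permutation group generated by all $L_a$, $a\in Q$; $Q$ is connected if it has only one orbit. A quandle $Q$ is quasi-reductive if there exist two different elements $a,b\in Q$ lying in the same orbit such that $L_a=L_b$. For $m\ge 1$, a quandle is $m$-reductive if it satisfies the identity $(((x\ast y)\ast y)\ast\cdots)\ast y\approx y$ with $m$ occurrences of $y$ on the left-hand side; it is reductive if it is $m$-reductive for some $m\ge1$. An Alexander quandle $(A,f)$ (up to isomorphism) is given by an abelian group $A$ and an automorphism $f$ of $A$, with operations $x\ast y=(1-f)(x)+f(y)$,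 $x\backslash y=(1-f^{-1})(x)+f^{-1}(y)$; it is cancellative if $\ast$ is cancellative on both sides. An algebra is subdirectly irreducible if the intersection of all its non-trivial congruences (congruences different from equality) is non-trivial (in particular it has at least two elements). *)

(* Defs.v *)
From HB Require Import structures.
From mathcomp Require Import all_boot ssralg all_classical.

Set Implicit Arguments.
Unset Strict Implicit.
Unset Printing Implicit Defensive.

Import GRing.Theory.

Declare Scope quandle_scope.
Delimit Scope quandle_scope with Qd.

Record quandle := Quandle {
  qcarrier :> Type;
  qop : qcarrier -> qcarrier -> qcarrier;
  qldiv : qcarrier -> qcarrier -> qcarrier;
  qopxx : forall x, qop x x = x;
  qopD : forall x y z, qop x (qop y z) = qop (qop x y) (qop x z);
  qopK : forall x y, qldiv x (qop x y) = y;
  qldivK : forall x y, qop x (qldiv x y) = y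
}.

Arguments qop {q} _ _.
Arguments qldiv {q} _ _.

Notation "x * y" := (qop x y) : quandle_scope.
Notation "x \ y" := (qldiv x y) (at level 50) : quandle_scope.

Local Open Scope quandle_scope.

Definition medial (Q : quandle) : Prop :=
  [/\ forall x y u v : Q, (x * y) * (u * v) = (x * u) * (y * v),
      forall x y u v : Q, (x \ y) \ (u \ v) = (x \ u) \ (y \ v)
    & forall x y u v : Q, (x \ y) * (u \ v) = (x * u) \ (y * v)].

Definition L (Q : quandle) (a : Q) : Q -> Q := fun x => a * x.
Definition R (Q : quandle) (a : Q) : Q -> Q := fun x => x * a.

Definition latin (Q : quandle) : Prop := forall a : Q, bijective (R a).

Definition cancellative (Q : quandle) : Prop :=
  (forall a : Q, injective (L a)) /\ (forall a : Q, injective (R a)).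

(* The permutation group of Q generated by all left translations. *)
Inductive lmlt (Q : quandle) : (Q -> Q) -> Prop :=
| lmlt_id : lmlt id
| lmlt_L (a : Q) : lmlt (L a)
| lmlt_comp (g h : Q -> Q) : lmlt g -> lmlt h -> lmlt (g \o h)
| lmlt_inv (g h : Q -> Q) : lmlt g -> cancel g h -> cancel h g -> lmlt h.

Definition same_orbit (Q : quandle) (x y : Q) : Prop :=
  exists2 g : Q -> Q, lmlt g & g x = y.

Definition connected (Q : quandle) : Prop := forall x y : Q, same_orbit x y.

Definition quasi_reductive (Q : quandle) : Prop :=
  exists a b : Q, [/\ a <> b, same_orbit a b & L a =1 L b].

Definition m_reductive (m : nat) (Q : quandle) : Prop :=
  forall x y : Q, iter m (R y) x = y.

Definition reductive (Q : quandle) : Prop :=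
  exists2 m : nat, 0 < m & m_reductive m Q.

Definition infinite (Q : quandle) : Prop := infinite_set [set: Q]%classic.

Record congruence (Q : quandle) (th : Q -> Q -> Prop) : Prop := Congruence {
  congr_refl : forall x, th x x;
  congr_sym : forall x y, th x y -> th y x;
  congr_trans : forall x y z, th x y -> th y z -> th x z;
  congr_op : forall x x' y y', th x x' -> th y y' -> th (x * y) (x' * y');
  congr_ldiv : forall x x' y y', th x x' -> th y y' -> th (x \ y) (x' \ y')
}.

Definition nontrivial_rel (T : Type) (th : T -> T -> Prop) : Prop :=
  ~ (forall x y, th x y <-> x = y).

(* When Q has no non-trivial congruence, [monolith Q] is the full relation;   *)
(* so quandles with at most one element are not subdirectly irreducible.      *)
Definition monolith (Q : quandle) (x y : Q) : Prop :=
  forall th : Q -> Q -> Prop, congruence th -> nontrivial_rel th -> th x y.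

Definition subdirectly_irreducible (Q : quandle) : Prop :=
  nontrivial_rel (@monolith Q).

Definition isomorphic (Q Q' : quandle) : Prop :=
  exists h : Q -> Q',
    [/\ bijective h,
        forall x y, h (x * y) = h x * h y
      & forall x y, h (x \ y) = h x \ h y].

Section Alexander.

Local Open Scope ring_scope.

(* An automorphism of A is given together with its inverse. *)
Variables (A : zmodType) (f g : {additive A -> A}).
Hypotheses (fK : cancel f g) (gK : cancel g f).

Definition alexander_op (x y : A) : A := (x - f x) + f y.
Definition alexander_ldiv (x y : A) : A := (x - g x) + g y.

Lemma alexander_opxx x : alexander_op x x = x.
Proof. by rewrite /alexander_op subrK. Qed.

Lemma alexander_opD x y z :
  alexander_op x (alexander_op y z)
  = alexander_op (alexander_op x y) (alexander_op x z).
Proof.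
rewrite /alexander_op; set a := x - f x + f y.
rewrite -[RHS]addrA [- f a + _]addrC -(raddfB f) /a opprD addrACA subrr add0r.
by rewrite -[RHS]addrA -(raddfD f) -(addrA y) [- f y + _]addrC.
Qed.

Lemma alexander_opK x y : alexander_ldiv x (alexander_op x y) = y.
Proof.
rewrite /alexander_ldiv /alexander_op raddfD raddfB !fK.
by rewrite addrA subrKA subrr add0r.
Qed.

Lemma alexander_ldivK x y : alexander_op x (alexander_ldiv x y) = y.
Proof.
rewrite /alexander_ldiv /alexander_op raddfD raddfB !gK.
by rewrite addrA subrKA subrr add0r.
Qed.

Definition alexander : quandle :=
  Quandle alexander_opxx alexander_opD alexander_opK alexander_ldivK.

End Alexander.

Definition is_alexander (Q : quandle) : Prop :=
  exists (A : zmodType) (f g : {additive A -> A})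
         (fK : cancel f g) (gK : cancel g f),
    isomorphic Q (alexander fK gK).

Definition infinite_connected_quasi_reductive (Q : quandle) : Prop :=
  [/\ connected Q, infinite Q & quasi_reductive Q].

Definition infinite_nonconnected_quasi_reductive_nonreductive (Q : quandle) :
    Prop :=
  [/\ ~ connected Q, infinite Q, quasi_reductive Q & ~ reductive Q].

Definition pairwise_exclusive (C1 C2 C3 C4 : Prop) : Prop :=
  [/\ ~ (C1 /\ C2), ~ (C1 /\ C3) & ~ (C1 /\ C4)] /\
  [/\ ~ (C2 /\ C3), ~ (C2 /\ C4) & ~ (C3 /\ C4)].

(* Main.v *)
(** Let D be the group generated by the L_a L_b^-1. Mediality makes D abelian,
    and conjugation by L_e is an automorphism f of D that does not depend on e.
    The orbits of an f-stable subgroup of D form a congruence of Q, and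
    L_(u x) = (1 - f)(u) L_x for u in D.

    If Q is not quasi-reductive, subdirect irreducibility makes either the orbit
    relation trivial, so that x * y = y, or Q faithful. In the faithful case D
    acts freely and 1 - f is injective on D, and all nonzero f-stable subgroups
    of D share a nonzero element; as Z[X] is Noetherian, this forces 1 - f to be
    surjective, whence Q is latin.

    If Q is finite, then by Fitting's lemma the kernel and image of (1 - f)^M
    meet trivially for M large, and so do their orbit congruences. One of them
    is thus trivial: the kernel is not when Q is quasi-reductive, so
    (1 - f)^M = 0, which means that Q is reductive.

    If Q is connected, D acts regularly, Q is the Alexander quandle (D, f), and
    1 - f is surjective, so that Q is not reductive. *)

From HB Require Import structures.
Require Import Defs.
From mathcomp Require Import all_boot ssralg all_classical.
From mathcomp Require Import all_order ssrnum ssrint intdiv poly zify.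

Set Implicit Arguments.
Unset Strict Implicit.
Unset Printing Implicit Defensive.

Import Order.TTheory GRing.Theory Num.Theory.
Local Open Scope ring_scope.

(** * Ascending chains of ideals in Z and Z[X] *)

Lemma chain_le (T : Type) (J : nat -> T -> Prop) (x : T) :
  (forall k y, J k y -> J k.+1 y) ->
  forall k l, (k <= l)%N -> J k x -> J l x.
Proof.
move=> JS k l /subnK <-; elim: (l - k)%N => // m IHm Jk.
by rewrite addSn; apply/JS/IHm.
Qed.

Lemma subgroup_mulrz (A : zmodType) (J : A -> Prop) (a : A) (z : int) :
  J 0 -> (forall x y, J x -> J y -> J (x - y)) -> J a -> J (a *~ z).
Proof.
move=> J0 JB Ja.
have Jn (n : nat) : J (a *+ n).
  elim: n => [|n IHn]; first by rewrite mulr0n.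
  by rewrite mulrS -[a *+ n]opprK; apply: (JB) => //; rewrite -sub0r; apply: JB.
case: z => n; first by rewrite -pmulrn.
by rewrite NegzE mulrNz -pmulrn -sub0r; apply: JB.
Qed.

(** The least positive integer of the union divides all its members, so the stage [K] where it
    appears already contains the union. *)
Lemma int_acc (J : nat -> int -> Prop) :
    (forall k, J k 0) -> (forall k a b, J k a -> J k b -> J k (a - b)) ->
    (forall k a, J k a -> J k.+1 a) ->
  exists K, forall k a, J k a -> J K a.
Proof.
move=> J0 JB JS.
have [[n [k Jk]]|J_eq0] := pselect (exists n k, J k n.+1%:Z); last first.
  exists 0%N => k a Jka; have [->//|a_neq0] := eqVneq a 0.
  case: J_eq0; exists (absz a).-1; exists k.
  have [a_ge0|a_lt0] := leP 0 a.
    by have -> : (absz a).-1.+1%:Z = a by lia.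
  have -> : (absz a).-1.+1%:Z = 0 - a by lia.
  exact: JB.
pose P n := `[< exists k, J k n.+1%:Z >].
have exP : exists n, P n by exists n; apply/asboolP; exists k.
have /asboolP[K JK] : P (ex_minn exP) by case: ex_minnP.
have minP m : P m -> (ex_minn exP <= m)%N by case: ex_minnP => m' _; exact.
move: (ex_minn exP) JK minP => d JK minP; exists K => l a Jla.
have Jq m : (K <= m)%N -> J m (d.+1%:Z *~ (a %/ d.+1%:Z)%Z).
  move=> Km; apply: (chain_le JS Km); apply: subgroup_mulrz => // x y.
  exact: JB.
have Jr : J (maxn K l) (a %% d.+1%:Z)%Z.
  have -> : (a %% d.+1%:Z)%Z = a - d.+1%:Z *~ (a %/ d.+1%:Z)%Z.
    by rewrite -mulrzl intz /modz.
  by apply: JB; [apply: (chain_le JS _ Jla)|apply: Jq]; lia.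
have r_ge0 : 0 <= (a %% d.+1%:Z)%Z by apply: modz_ge0.
have r_lt : (a %% d.+1%:Z)%Z < d.+1%:Z by apply: ltz_pmod.
have [r0|r_neq0] := eqVneq (a %% d.+1%:Z)%Z 0.
  rewrite (divz_eq a d.+1%:Z) r0 addr0 -[X in X * _]intz mulrzl.
  exact: Jq.
have /minP : P (absz (a %% d.+1%:Z)%Z).-1; last by lia.
apply/asboolP; exists (maxn K l).
by have -> : (absz (a %% d.+1%:Z)%Z).-1.+1%:Z = (a %% d.+1%:Z)%Z by lia.
Qed.

(* Hilbert's basis theorem for Z[X], in the form of the ascending chain       *)
(* condition: [lc d k] is the ideal of the coefficients at degree d of the    *)
(* members of [I k] of degree at most d; the doubly indexed family stabilizes *)
(* along the diagonal, and along k for each of the finitely many smaller d.   *)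
Lemma poly_int_acc (I : nat -> {poly int} -> Prop) :
    (forall k, I k 0) -> (forall k p q, I k p -> I k q -> I k (p - q)) ->
    (forall k p, I k p -> I k ('X * p)) -> (forall k p, I k p -> I k.+1 p) ->
  exists K, forall k p, I k p -> I K p.
Proof.
move=> I0 IB IX IS.
pose lc d k c := exists p, [/\ I k p, (size p <= d.+1)%N & p`_d = c].
have lc0 d k : lc d k 0.
  by exists 0; rewrite size_poly0 coef0.
have lcB d k a b : lc d k a -> lc d k b -> lc d k (a - b).
  move=> [p [Ip sp <-]] [q [Iq sq <-]]; exists (p - q); split.
  - exact: IB.
  - by rewrite (leq_trans (size_polyD _ _))// size_polyN geq_max sp.
  - by rewrite coefB.
have lcSk d k a : lc d k a -> lc d k.+1 a.
  by move=> [p [Ip sp <-]]; exists p; split=> //; apply: IS.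
have lcSd k d a : lc d k a -> lc d.+1 k a.
  move=> [p [Ip sp <-]]; exists ('X * p); split; first exact: IX.
  - by rewrite mulrC (leq_trans (size_polyMleq _ _))// size_polyX addn2.
  - by rewrite coefXM.
have lc_le d k d' k' a : (d <= d')%N -> (k <= k')%N -> lc d k a -> lc d' k' a.
  move=> dd' kk' lca; apply: (chain_le (J := fun d => lc d k') _ dd').
    by move=> ? ?; apply: lcSd.
  exact: (chain_le (@lcSk d) kk').
have [K0 K0P] : exists K, forall k a, lc k k a -> lc K K a.
  by apply: int_acc => // [k a b|k a lca]; [apply: lcB|apply/lcSk/lcSd].
have /choice[Kd KdP] d : exists K, forall k a, lc d k a -> lc d K a.
  exact: int_acc (lc0 d) (@lcB d) (@lcSk d).
pose K := maxn K0 (\max_(d < K0) Kd d); exists K => k p.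
move: {2}(size p) (leqnn (size p)) => n; elim: n => [|n IHn] in k p *.
  by rewrite leqn0 size_poly_eq0 => /eqP ->.
move=> sp Ip.
have lcn : lc n k p`_n by exists p.
have [q [Iq sq qn]] : lc n K p`_n.
  have [nK0|K0n] := ltnP n K0.
    have KdK : (Kd n <= K)%N.
      have := leq_bigmax (F := fun d : 'I_K0 => Kd d) (Ordinal nK0).
      by rewrite leq_max => ->; rewrite orbT.
    exact: lc_le (leqnn n) KdK (KdP _ _ _ lcn).
  have lcnk : lc (maxn n k) (maxn n k) p`_n.
    by apply: lc_le lcn; rewrite ?leq_maxl ?leq_maxr.
  by apply: lc_le (K0P _ _ lcnk); rewrite ?leq_maxl.
rewrite -(subrK q p) -[q in _ + q]opprK; apply: (IB) => //; last first.
  by rewrite -sub0r; apply: IB.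
(* The coefficients at degree [n] cancel, so [p - q] has size at most [n]; it lies in stage
   [maxn k K], hence the induction for all [k]. *)
apply: (IHn (maxn k K)).
  apply/leq_sizeP => j; rewrite leq_eqVlt coefB => /orP[/eqP <-|nj].
    by rewrite qn subrr.
  by rewrite !(leq_sizeP _ _ _ j nj) ?subr0.
by apply: IB; [apply: (chain_le IS _ Ip)|apply: (chain_le IS _ Iq)];
  rewrite ?leq_maxl ?leq_maxr.
Qed.

(** * Integer polynomials in an endomorphism *)

Section PolyAction.
Variables (A : zmodType) (f : {additive A -> A}).

(** The Z[X]-module structure on [A] in which ['X] acts as [f]. *)
Definition pact (p : {poly int}) (x : A) : A :=
  \sum_(i < size p) iter i f x *~ p`_i.

Lemma pact_widen n (p : {poly int}) x : (size p <= n)%N ->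
  pact p x = \sum_(i < n) iter i f x *~ p`_i.
Proof.
move=> pn; rewrite /pact (big_ord_widen n (fun i => iter i f x *~ p`_i) pn).
rewrite big_mkcond; apply: eq_bigr => i _.
by case: ltnP => // pi; rewrite nth_default// mulr0z.
Qed.

Lemma iter_raddfB n x y : iter n f (x - y) = iter n f x - iter n f y.
Proof. by elim: n => //= n ->; rewrite raddfB. Qed.

Lemma pactBr p x y : pact p (x - y) = pact p x - pact p y.
Proof.
rewrite /pact -sumrB; apply: eq_bigr => i _.
by rewrite iter_raddfB mulrzBl.
Qed.

Lemma pactBl p q x : pact (p - q) x = pact p x - pact q x.
Proof.
have sB : (size (p - q)%R <= maxn (size p) (size q))%N.
  by rewrite (leq_trans (size_polyD _ _))// size_polyN.
rewrite !(@pact_widen (maxn (size p) (size q)))// ?leq_maxl ?leq_maxr//.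
by rewrite -sumrB; apply: eq_bigr => i _; rewrite coefB mulrzBr.
Qed.

Lemma pact0l x : pact 0 x = 0.
Proof. by rewrite -(subrr (1 : {poly int})) pactBl subrr. Qed.

Lemma pact0r p : pact p 0 = 0.
Proof. by have := pactBr p 0 0; rewrite !subrr. Qed.

Lemma pactNl p x : pact (- p) x = - pact p x.
Proof. by have := pactBl 0 p x; rewrite pact0l !sub0r. Qed.

Lemma pactDl p q x : pact (p + q) x = pact p x + pact q x.
Proof. by rewrite -[q in LHS]opprK pactBl pactNl opprK. Qed.

Lemma pactC c x : pact c%:P x = x *~ c.
Proof. by rewrite (@pact_widen 1) ?size_polyC_leq1// big_ord1 coefC. Qed.

Lemma pact1 x : pact 1 x = x.
Proof. exact: pactC. Qed.

Lemma pact_comm p x : pact p (f x) = f (pact p x).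
Proof.
rewrite /pact raddf_sum; apply: eq_bigr => i _.
by rewrite raddfMz -iterSr.
Qed.

Lemma pactXl p x : pact ('X * p) x = f (pact p x).
Proof.
rewrite (@pact_widen (size p).+1) mulrC; last first.
  by rewrite (leq_trans (size_polyMleq _ _))// size_polyX addn2.
rewrite big_ord_recl coefMX mulr0z add0r raddf_sum; apply: eq_bigr => i _.
by rewrite coefMX raddfMz.
Qed.

Lemma pactM p q x : pact (p * q) x = pact p (pact q x).
Proof.
elim/poly_ind: p => [|p c IHp]; first by rewrite mul0r !pact0l.
rewrite mulrDl -[p * 'X]mulrC -mulrA !pactDl !pactXl IHp; congr (_ + _).
rewrite pactC mul_polyC.
elim/int_rect: c => [|n|n]; first by rewrite scale0r pact0l.
- by rewrite -addn1 PoszD scalerDl mulrzDr pactDl scale1r => ->.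
- by rewrite -addn1 PoszD opprD scalerDl mulrzDr pactDl scaleN1r pactNl => ->.
Qed.

Lemma pactX x : pact 'X x = f x.
Proof. by rewrite -['X]mulr1 pactXl pact1. Qed.

Lemma pactXn n x : pact 'X^n x = iter n f x.
Proof. by elim: n => [|n IHn]; rewrite ?pact1// exprS pactXl IHn. Qed.

Lemma pact1BX x : pact (1 - 'X) x = x - f x.
Proof. by rewrite pactBl pact1 pactX. Qed.

End PolyAction.

(** * Modules over Z[X, 1/X] with a smallest nonzero submodule *)

Definition stable_subgroup (A : zmodType) (f g : A -> A) (N : A -> Prop) :=
  [/\ N 0, forall x y, N x -> N y -> N (x - y),
      forall x, N x -> N (f x) & forall x, N x -> N (g x)].

Section UniformModule.
Variables (A : zmodType) (f g : {additive A -> A}).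
Hypotheses (fK : cancel f g) (gK : cancel g f).

(** The Z[X, 1/X]-submodule spanned by [y], with the denominator, a power of [f], cleared. *)
Definition generated (y z : A) : Prop :=
  exists n p, iter n f z = pact f p y.

Lemma generated_stable y : stable_subgroup f g (generated y).
Proof.
split.
- by exists 0%N, 0; rewrite pact0l.
- move=> z z' [n [p zp]] [m [q zq]]; exists (n + m)%N, ('X^m * p - 'X^n * q).
  rewrite iter_raddfB pactBl !pactM !pactXn -zp -zq -!iterD.
  by rewrite [(m + n)%N]addnC.
- by move=> z [n [p zp]]; exists n, ('X * p); rewrite pactXl -zp -iterSr.
- by move=> z [n [p zp]]; exists n.+1, p; rewrite iterSr gK.
Qed.

Lemma generated_refl y : generated y y.
Proof. by exists 0%N, 1; rewrite pact1. Qed.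

Lemma iter_additive_can_eq0 n x : iter n f x = 0 -> x = 0.
Proof. by elim: n => //= n IHn /(congr1 g); rewrite fK raddf0. Qed.

Variable x0 : A.
Hypotheses (x0_neq0 : x0 <> 0)
  (x0_min : forall N,
     stable_subgroup f g N -> (exists2 x, N x & x <> 0) -> N x0).

(* Some polynomial v with v(1) = 1 kills x0, since 1 - f is injective on the *)
(* simple module generated by x0; the kernels of the powers of v on the      *)
(* module generated by y stabilize, so v is nilpotent there, and 1 - f is    *)
(* invertible modulo v^K.                                                    *)
Lemma uniform_surjective :
    (forall x, x - f x = 0 -> x = 0) -> forall y, exists x, x - f x = y.
Proof.
move=> inj1f y.
have x0_gen z : z <> 0 -> generated z x0.
  move=> z0; apply: x0_min (generated_stable z) _.
  by exists z => //; apply: generated_refl.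
have [n [p x0p]] : generated (x0 - f x0) x0 by apply: x0_gen => /inj1f.
pose v := 'X^n - p * (1 - 'X).
have vx0 : pact f v x0 = 0 by rewrite pactBl pactM pactXn pact1BX x0p subrr.
have [||||K IK] :=
    @poly_int_acc (fun k q => pact f (v ^+ k * q) y = 0).
- by move=> k; rewrite mulr0 pact0l.
- by move=> k q q' eq0 eq'0; rewrite mulrBr pactBl eq0 eq'0 subrr.
- by move=> k q eq0; rewrite mulrCA pactXl eq0 raddf0.
- by move=> k q eq0; rewrite exprS -mulrA pactM eq0 pact0r.
have vy0 : pact f (v ^+ K.+1) y = 0.
  (* Otherwise f^m x0 = q v^(K+1) y. As [v] kills [x0], v^(K+2) q kills [y]; by the choice of [K] so
     does v^K q, whence f^m x0 = 0. *)
  apply: contrapT => /x0_gen[m [q x0q]]; apply: x0_neq0.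
  have qI : pact f (v ^+ K.+2 * q) y = 0.
    rewrite exprS -mulrA [_ * q]mulrC pactM [pact _ (q * _) y]pactM -x0q.
    by rewrite -pactXn -pactM mulrC pactM vx0 pact0r.
  apply: (@iter_additive_can_eq0 m); rewrite x0q -pactM mulrC exprS.
  by rewrite -mulrA pactM (IK _ _ qI) pact0r.
(* [v] is congruent to X^n modulo 1 - X, so their powers are congruent too. *)
have [w vE] : exists w, v ^+ K.+1 = 'X^(n * K.+1) - w * (1 - 'X).
  exists ((\sum_(i < K.+1) ('X^n) ^+ (K - i) * v ^+ i) * p).
  rewrite -[LHS](subKr ('X^n ^+ K.+1)) subrXX exprM [X in _ - X * _]subKr.
  by rewrite mulrC mulrA.
have iterfK m : cancel (iter m g) (iter m f).
  by elim: m => // m IHm x; rewrite iterSr (iterS m g) gK IHm.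
(* From v^(K+1) y = 0, f^(n(K+1)) y = (1 - f)(w y); the power of [f] is then divided out. *)
exists (iter (n * K.+1) g (pact f w y)).
apply/eqP; rewrite -subr_eq0; apply/eqP.
apply: (@iter_additive_can_eq0 (n * K.+1)).
rewrite !iter_raddfB -iterSr iterS iterfK -pact1BX -pactM -pactXn -pactBl mulrC.
by rewrite -opprB pactNl -vE vy0 oppr0.
Qed.

End UniformModule.

(** * Displacements of a quandle; they commute in a medial one *)

Section Displacement.
Local Open Scope quandle_scope.
Variable Q : quandle.
Implicit Types (a b x y : Q) (g h : Q -> Q).

Lemma qop_inj x : injective (qop x).
Proof. exact: can_inj (qopK x). Qed.

Lemma ldivxx x : x \ x = x.
Proof. by apply: (@qop_inj x); rewrite qldivK qopxx. Qed.

Lemma ldivD x y z : x \ (y * z) = (x \ y) * (x \ z).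
Proof. by apply: (@qop_inj x); rewrite qopD !qldivK. Qed.

Lemma op_ldiv x y z : x * (y \ z) = (x * y) \ (x * z).
Proof. by apply: (@qop_inj (x * y)); rewrite -qopD !qldivK. Qed.

Lemma ldiv_ldiv x y z : x \ (y \ z) = (x \ y) \ (x \ z).
Proof. by apply: (@qop_inj (x \ y)); rewrite -ldivD !qldivK. Qed.

Inductive displacement : (Q -> Q) -> Prop :=
| displacement_id : displacement id
| displacement_cons a b g :
    displacement g -> displacement (fun x => a * (b \ g x)).

Lemma displacement_gen a b : displacement (fun x => a * (b \ x)).
Proof. exact: (displacement_cons a b displacement_id). Qed.

Lemma displacement_comp g h :
  displacement g -> displacement h -> displacement (g \o h).
Proof.
move=> + Dh; elim=> [|a b {}g _ Dgh]; first exact: Dh.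
exact: (displacement_cons a b Dgh).
Qed.

Lemma displacement_inv g :
  displacement g -> exists h, [/\ displacement h, cancel g h & cancel h g].
Proof.
elim=> [|a b {}g _ [h [Dh gK hK]]].
  by exists id; split=> //; exact: displacement_id.
exists (h \o (fun x => b * (a \ x))); split.
- by apply: displacement_comp => //; apply: displacement_gen.
- by move=> x /=; rewrite qopK qldivK gK.
- by move=> x /=; rewrite hK qopK qldivK.
Qed.

Lemma displacement_op g x y : displacement g -> g (x * y) = g x * g y.
Proof. by elim=> // a b {}g _ ->; rewrite ldivD qopD. Qed.

Lemma displacement_lmlt g : displacement g -> lmlt g.
Proof.
elim=> [|a b {}g _ lg]; first exact: lmlt_id.
apply: (lmlt_comp (lmlt_L a)); apply: lmlt_comp lg.
by apply: (lmlt_inv (lmlt_L b)) => x; rewrite /L ?qopK ?qldivK.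
Qed.

(** [L e] is an automorphism, so it conjugates L_a L_b^-1 into L_a' L_b'^-1 with a' = e * a and b' =
    e * b. *)
Lemma displacement_conj e g :
  displacement g -> displacement (fun x => e * g (e \ x)).
Proof.
elim=> [|a b {}g _ Dg].
  rewrite (_ : (fun x => _) = id); first exact: displacement_id.
  by apply/funext => x; rewrite qldivK.
rewrite (_ : (fun x => _) = fun x => (e * a) * ((e * b) \ (e * g (e \ x)))).
  exact: displacement_cons.
by apply/funext => x; rewrite qopD op_ldiv.
Qed.

Lemma displacement_conjV e g :
  displacement g -> displacement (fun x => e \ g (e * x)).
Proof.
elim=> [|a b {}g _ Dg].
  rewrite (_ : (fun x => _) = id); first exact: displacement_id.
  by apply/funext => x; rewrite qopK.
rewrite (_ : (fun x => _) = fun x => (e \ a) * ((e \ b) \ (e \ g (e * x)))).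
  exact: displacement_cons.
by apply/funext => x; rewrite ldivD ldiv_ldiv.
Qed.

Hypothesis Qm : medial Q.

(** Applying [L x] to both sides yields the medial law for [x], [y], [u], [v]. *)
Lemma medial_swap x y u v : y * (x \ (u * v)) = u * (x \ (y * v)).
Proof.
have [med _ _] := Qm; apply: (@qop_inj x).
by rewrite !(qopD x) !qldivK med.
Qed.

Lemma displacement_gen_comm a b c d x :
  a * (b \ (c * (d \ x))) = c * (d \ (a * (b \ x))).
Proof.
(* This is [medial_swap] for inverses: L_d^-1 L_a L_b^-1 is symmetric in [b] and [d]. *)
have -> : d \ (a * (b \ x)) = b \ (a * (d \ x)).
  by apply: (@qop_inj b); rewrite qldivK medial_swap qldivK.
by rewrite medial_swap.
Qed.

Lemma displacement_comm g h x :
  displacement g -> displacement h -> g (h x) = h (g x).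
Proof.
move=> Dg; elim: Dg h x => // a b {}g _ IHg h x Dh; rewrite IHg//.
elim: Dh (g x) => // c d {}h _ IHh y.
by rewrite displacement_gen_comm IHh.
Qed.

(* Conjugation by L_a does not depend on a, as L_a L_e^-1 commutes with g. *)
Lemma displacement_conj_indep a e g x :
  displacement g -> a * g (a \ x) = e * g (e \ x).
Proof.
move=> Dg.
have := displacement_comm (e * (a \ x)) (displacement_gen a e)
  (displacement_conj e Dg).
by rewrite /= !qopK qldivK.
Qed.

End Displacement.

(** * The displacement group as an abelian group with an automorphism *)

(** The proof of mediality is a parameter so that the type can carry the abelian group structure,
    whose commutativity rests on it. *)
Definition dis (Q : quandle) (Qm : medial Q) := {g : Q -> Q | displacement g}.

Section DisGroup.
Variables (Q : quandle) (Qm : medial Q).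
Local Notation D := (dis Qm).

HB.instance Definition _ := gen_eqMixin D.
HB.instance Definition _ := gen_choiceMixin D.

Definition dapp (u : D) : Q -> Q := sval u.

Lemma dapp_displacement (u : D) : displacement (dapp u).
Proof. exact: svalP. Qed.
Hint Resolve dapp_displacement : core.

Lemma dis_eq (u v : D) : dapp u =1 dapp v -> u = v.
Proof.
case: u v => [g Dg] [h Dh] /funext; rewrite /dapp /= => gh.
by subst h; rewrite (Prop_irrelevance Dg Dh).
Qed.

Definition dis0 : D := exist _ id (@displacement_id Q).
Definition disD (u v : D) : D :=
  exist _ _ (displacement_comp (svalP u) (svalP v)).
Definition disN (u : D) : D :=
  let h := cid (displacement_inv (svalP u)) in
  exist _ (sval h) (let: And3 Dh _ _ := svalP h in Dh).

Lemma disN_K (u : D) : cancel (dapp u) (dapp (disN u)).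
Proof. by rewrite /dapp /disN /=; case: cid => h []. Qed.

Lemma disDA : associative disD.
Proof. by move=> u v w; apply: dis_eq. Qed.

Lemma disDC : commutative disD.
Proof.
move=> u v; apply: dis_eq => x.
exact: (displacement_comm Qm) (svalP u) (svalP v).
Qed.

Lemma dis0D : left_id dis0 disD.
Proof. by move=> u; apply: dis_eq. Qed.

Lemma disND : left_inverse dis0 disN disD.
Proof. by move=> u; apply: dis_eq => x; apply: disN_K. Qed.

HB.instance Definition _ := GRing.isZmodule.Build D disDA disDC dis0D disND.

Implicit Types u v w : D.

Lemma dappD u v x : dapp (u + v) x = dapp u (dapp v x). Proof. by []. Qed.
Lemma dappNK u : cancel (dapp u) (dapp (- u)). Proof. exact: disN_K. Qed.
Lemma dappKN u : cancel (dapp (- u)) (dapp u).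
Proof. by move=> x; rewrite -dappD subrr. Qed.

Definition disL (a b : Q) : D := exist _ _ (displacement_gen a b).

Lemma dapp_disL a b x : dapp (disL a b) x = qop a (qldiv b x).
Proof. by []. Qed.

Lemma dis_ind (P : D -> Prop) :
  P 0 -> (forall a b u, P u -> P (disL a b + u)) -> forall u, P u.
Proof.
move=> P0 PD [g Dg]; have Dg' := Dg; elim: Dg' Dg => [|a b {}g Dg IHg] D'.
  by rewrite (_ : exist _ _ _ = 0 :> D)//; apply: dis_eq.
rewrite (_ : exist _ _ _ = disL a b + exist _ g Dg :> D); last exact: dis_eq.
exact/PD/IHg.
Qed.

Definition conj (e : Q) u : D := exist _ _ (displacement_conj e (svalP u)).
Definition conjV (e : Q) u : D := exist _ _ (displacement_conjV e (svalP u)).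

Local Open Scope quandle_scope.

Lemma dapp_conj e u x : dapp (conj e u) x = e * dapp u (e \ x).
Proof. by []. Qed.

Lemma dapp_op u x y : dapp u (x * y) = dapp u x * dapp u y.
Proof. exact: displacement_op. Qed.

Lemma dapp_comm u v x : dapp u (dapp v x) = dapp v (dapp u x).
Proof. exact: (displacement_comm Qm). Qed.

(** Displacements have the same orbits as all left translations, because L_a x = L_a L_x^-1 x. *)
Lemma same_orbitP x y : same_orbit x y <-> exists u, dapp u x = y.
Proof.
split=> [[g lg <-]|[u <-]]; last first.
  by exists (dapp u) => //; apply: displacement_lmlt.
elim: lg x => {g} [x|a x|g h _ IHg _ IHh x|g h _ IHg gK hK x].
- by exists 0.
- by exists (disL a x); rewrite dapp_disL ldivxx.
- have [v vx] := IHh x; have [u ux] := IHg (h x).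
  by exists (u + v)%R; rewrite dappD vx ux.
- have [u ux] := IHg (h x); exists (- u)%R.
  by rewrite -[x in LHS]hK -ux dappNK.
Qed.

Section Conjugation.
Variable e : Q.

Lemma conj_additive : zmod_morphism (conj e).
Proof.
move=> u v; apply: (addIr (conj e v)); rewrite subrK.
apply: dis_eq => x; rewrite dappD !dapp_conj qopK -dappD.
by rewrite subrK.
Qed.
HB.instance Definition _ :=
  GRing.isZmodMorphism.Build D D (conj e) conj_additive.

Lemma conjK : cancel (conj e) (conjV e).
Proof. by move=> u; apply: dis_eq => x; rewrite /dapp /= !qopK. Qed.

Lemma conjVK : cancel (conjV e) (conj e).
Proof. by move=> u; apply: dis_eq => x; rewrite /dapp /= !qldivK. Qed.

Lemma conjV_additive : zmod_morphism (conjV e).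
Proof.
by move=> u v; apply: (can_inj conjK); rewrite raddfB /= !conjVK.
Qed.
HB.instance Definition _ :=
  GRing.isZmodMorphism.Build D D (conjV e) conjV_additive.

Lemma conjB u v : conj e (u - v)%R = (conj e u - conj e v)%R.
Proof. exact: raddfB. Qed.

Lemma conjN u : conj e (- u)%R = (- conj e u)%R.
Proof. exact: raddfN. Qed.

Lemma conjD u v : conj e (u + v)%R = (conj e u + conj e v)%R.
Proof. exact: raddfD. Qed.

Lemma op_dapp u x y : x * dapp u y = dapp (conj e u) (x * y).
Proof.
rewrite dapp_conj -(displacement_conj_indep Qm x e) ?qopK//.
Qed.

(** As [u] is an automorphism, (u x) * y = u (x * u^-1 y), and moving u^-1 out past L_x turns it
    into f(u^-1). *)
Lemma dapp_op_l u x y : dapp u x * y = dapp (u - conj e u)%R (x * y).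
Proof.
by rewrite dappD -[y in LHS](dappKN u) -dapp_op op_dapp conjN.
Qed.

Lemma dapp_op2 u v x y :
  dapp u x * dapp v y = dapp (u - conj e u + conj e v)%R (x * y).
Proof. by rewrite dapp_op_l op_dapp. Qed.

Lemma disL_dapp u x : disL (dapp u x) x = (u - conj e u)%R.
Proof. by apply: dis_eq => y; rewrite dapp_disL dapp_op_l qldivK. Qed.

(** (1 - f)(u) is L_(u x) L_x^-1, the identity when [u] fixes [x]. *)
Lemma stab_conj u x : dapp u x = x -> conj e u = u.
Proof.
move=> ux; apply/eqP; rewrite eq_sym -subr_eq0 -(disL_dapp u x) ux.
by apply/eqP/dis_eq => y; rewrite dapp_disL qldivK.
Qed.

Lemma L_eq_conj u x : L (dapp u x) =1 L x <-> conj e u = u.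
Proof.
split=> [ux|ue y]; last by rewrite /L dapp_op_l ue subrr.
apply/eqP; rewrite eq_sym -subr_eq0 -(disL_dapp u x); apply/eqP/dis_eq => y.
by rewrite dapp_disL [LHS]ux /L qldivK.
Qed.

(** On the orbit of [y], [R y] acts as 1 - f; this translates reductivity into nilpotency of 1 -
    f. *)
Lemma iter_R_dapp k u y : 
  iter k (R y) (dapp u y) = dapp (pact (conj e) ((1 - 'X) ^+ k)%R u) y.
Proof.
elim: k => [|k IHk]; first by rewrite expr0 pact1.
by rewrite iterS IHk /R dapp_op_l qopxx exprS pactM pact1BX.
Qed.

Definition orbit_rel (N : D -> Prop) x y := exists2 u, N u & dapp u x = y.

Lemma orbit_congruence N :
  stable_subgroup (conj e) (conjV e) N -> congruence (orbit_rel N).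
Proof.
move=> [N0 NB Nf Ng].
have NN u : N u -> N (- u)%R by move=> Nu; rewrite -sub0r; apply: NB.
have ND u v : N u -> N v -> N (u + v)%R.
  by move=> Nu Nv; rewrite -[v]opprK; apply/NB/NN.
split.
- by move=> x; exists 0.
- by move=> x y [u Nu <-]; exists (- u)%R; [apply: NN|rewrite dappNK].
- move=> x y z [u Nu <-] [v Nv <-].
  by exists (v + u)%R; [apply: ND|rewrite dappD].
- move=> x _ y _ [u Nu <-] [v Nv <-].
  exists (u - conj e u + conj e v)%R; last by rewrite dapp_op2.
  by apply: ND; [apply: NB => //|]; apply: Nf.
- move=> x _ y _ [u Nu <-] [v Nv <-].
  (* The solution w of u - f(u) + f(w) = v, the condition for (u x) * w (x \ y) = v y. *)
  exists (conjV e v - conjV e u + u)%R.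
    by apply: ND => //; apply: NB; apply: Ng.
  apply: (@qop_inj _ (dapp u x)); rewrite qldivK dapp_op2.
  rewrite conjD conjB !conjVK [X in dapp X](_ : _ = v) ?qldivK//.
  by rewrite addrC -addrA [(conj e u + _)%R]addrC !subrK.
Qed.

Lemma orbit_rel_trivial N u :
  (forall x y, orbit_rel N x y <-> x = y) -> N u -> u = 0%R.
Proof.
by move=> Ntriv Nu; apply: dis_eq => x; apply/esym/Ntriv; exists u.
Qed.

End Conjugation.

End DisGroup.

(** * Subdirectly irreducible medial quandles *)

Lemma bijectiveP (T U : Type) (h : T -> U) :
  injective h -> (forall y, exists x, h x = y) -> bijective h.
Proof. by move=> inj /choice[g gK]; exists g => // x; apply/inj/gK. Qed.

Section MedialQuandle.
Local Open Scope quandle_scope.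
Variable Q : quandle.

(** The translation of a product depends only on those of its factors: it is L_x L_y L_x^-1. *)
Lemma L_congruence : congruence (fun x y : Q => L x =1 L y).
Proof.
split=> [//|x y xy|x y z xy yz|x x' y y' xx' yy'|x x' y y' xx' yy'].
- by move=> w; exact: esym (xy w).
- by move=> w; exact: etrans (xy w) (yz w).
- have Lop (a b c : Q) : L (a * b) c = a * (b * (a \ c)).
    by rewrite /L qopD qldivK.
  move=> z; rewrite !Lop; have xx'V : x \ z = x' \ z.
    by apply: (@qop_inj _ x); rewrite qldivK [RHS]xx' /L qldivK.
  by rewrite [LHS]xx' /L xx'V [y * _]yy'.
- have Lop (a b c : Q) : L (a \ b) c = a \ (b * (a * c)).
    by rewrite /L ldivD qopK.
  move=> z; rewrite !Lop [x * z]xx' /L [y * _]yy' /L.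
  by apply: (@qop_inj _ x); rewrite qldivK [RHS]xx' /L qldivK.
Qed.

Lemma subdirectly_irreducible_pair : subdirectly_irreducible Q ->
  exists a b : Q, a <> b /\
    forall th, congruence th -> (forall x y, th x y <-> x = y) \/ th a b.
Proof.
move=> Qsi; apply: contrapT => noab; apply: Qsi => a b.
split=> [mab|-> th]; last first.
  by move=> th_congr _; apply: congr_refl.
apply: contrapT => ab; apply: noab; exists a, b; split=> // th th_congr.
have [?|thN] := pselect (forall x y, th x y <-> x = y); first by left.
by right; apply: mab.
Qed.

Hypothesis Qm : medial Q.
Local Notation D := (dis Qm).

Lemma stable_subgroupT (e : Q) :
  stable_subgroup (conj (Qm := Qm) e) (conjV e) (fun=> True).
Proof. by []. Qed.

Section SubdirectlyIrreducible.
Variables a b : Q.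
Hypotheses (ab : a <> b) (ab_min :
  forall th : Q -> Q -> Prop, congruence th ->
    (forall x y, th x y <-> x = y) \/ th a b).

(** Minimality seen in the group: when the action is free, the element sending [a] to [b] is the
    same for all [N]. *)
Lemma orbit_min (N : D -> Prop) :
  stable_subgroup (conj a) (conjV a) N -> (exists2 u, N u & u <> 0%R) ->
  exists2 u, N u & dapp u a = b.
Proof.
move=> /orbit_congruence/ab_min[Ntriv [u Nu]|//].
by rewrite (orbit_rel_trivial Ntriv Nu).
Qed.

Lemma orbits_trivial_or_min : reductive Q \/ exists u : D, dapp u a = b.
Proof.
have /orbit_congruence/ab_min[Ttriv|[u _ ub]] := stable_subgroupT a; last first.
  by right; exists u.
left; exists 1 => // x y; apply/esym/Ttriv.
have [|u uy] := (same_orbitP Qm y (x * y)).1.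
  by exists (L x); first exact: lmlt_L.
by exists u.
Qed.

Lemma not_quasi_reductive_latin : ~ quasi_reductive Q -> latin Q \/ reductive Q.
Proof.
move=> notQR; have [|[u0 u0a]] := orbits_trivial_or_min; first by right.
have [faithful|Lab] := ab_min L_congruence; last first.
  case: notQR; exists a, b; split=> //.
  by apply/(same_orbitP Qm); exists u0.
left.
have conj_fix (u : D) : conj a u = u -> u = 0%R.
  by move=> ufix; apply: dis_eq => x; apply/faithful; apply/(L_eq_conj a).
have regular (u : D) x : dapp u x = x -> u = 0%R.
  by move=> /(stab_conj a)/conj_fix.
have disL_inj z x y : disL Qm x z = disL Qm y z -> x = y.
  move=> xy; apply/faithful => w.
  by rewrite /L -(qopK z w) -!(dapp_disL Qm) xy.
have surj := @uniform_surjective _ (conj (Qm := Qm) a) (conjV a)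
  (@conjK _ Qm a) (@conjVK _ Qm a) u0.
have {}surj (v : D) : exists u, (u - conj a u)%R = v.
  apply: surj.
  - by move=> u00; apply: ab; rewrite -u0a u00.
  - move=> N Nst /(orbit_min Nst)[u Nu ua].
    suff -> : u0 = u by [].
    apply/eqP; rewrite eq_sym -subr_eq0; apply/eqP/(regular _ b).
    by rewrite -{1}u0a -dappD subrK ua.
  - by move=> u /eqP; rewrite subr_eq0 eq_sym => /eqP/conj_fix.
(* If x * c = y * c, then L_x L_y^-1 fixes y * c, so it is the identity and faithfulness gives x =
   y. *)
move=> c; apply: bijectiveP => [x y xyc|y].
  have xy0 : disL Qm x y = 0%R.
    by apply: (regular _ (y * c)); rewrite dapp_disL qopK; exact: xyc.
  apply: (disL_inj y); rewrite xy0; apply/esym/(regular _ y).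
  by rewrite dapp_disL qldivK.
(* For surjectivity 1 - f is inverted twice: first to write y = u c, then to write u = (1 - f)(v),
   so that (v c) * c = u c. *)
have [u uyc] := surj (disL Qm y c).
have uc : dapp u c = y.
  by apply: (disL_inj c); rewrite (disL_dapp a).
have [v vu] := surj u; exists (dapp v c).
by rewrite /R (dapp_op_l a) qopxx vu.
Qed.

Lemma finite_quasi_reductive_reductive :
  finite_set [set: Q]%classic -> quasi_reductive Q -> reductive Q.
Proof.
move=> Qfin [c [d [cd cd_orbit Lcd]]].
(* [Q] being finite, one exponent serves all [x]: the iterates stay at [a] once they reach it. *)
have [K KP] : exists K, forall x,
    (exists k, iter k (R a) x = a) -> iter K (R a) x = a.
  have /finite_seqP[s sE] : finite_set [set: {classic Q}]%classic := Qfin.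
  suff [K KP] : exists K, forall x : {classic Q}, x \in s ->
      (exists k, iter k (R a) x = a) -> iter K (R a) x = a.
    exists K => x; apply: KP.
    by have : [set: {classic Q}]%classic x by []; rewrite sE.
  elim: s {sE} => [|x s [K KP]]; first by exists 0%N.
  have iter_ge k l y : (k <= l)%N -> iter k (R a) y = a -> iter l (R a) y = a.
    move=> /subnK <- yk; rewrite iterD yk; elim: (l - k)%N => //= m ->.
    exact: qopxx.
  have [[k xk]|xN] := pselect (exists k, iter k (R a) x = a); last first.
    by exists K => y; rewrite inE => /predU1P[->|/KP].
  exists (maxn k K) => y; rewrite inE => /predU1P[-> _|ys /(KP _ ys)].
    by apply: iter_ge xk; rewrite leq_maxl.
  by apply: iter_ge; rewrite leq_maxr.
pose phi k (u : D) : D := pact (conj a) ((1 - 'X) ^+ k)%R u.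
have phiD k l u : phi (k + l)%N u = phi k (phi l u) by rewrite /phi exprD pactM.
have phi1 u : phi 1 u = (u - conj a u)%R by rewrite /phi expr1 pact1BX.
have phi0 k : phi k 0%R = 0%R by exact: pact0r.
(* [K] only brings (1 - f)^K u into the stabilizer of [a]; one more factor 1 - f kills it, by
   [stab_conj]. *)
pose M := K.+1.
have phi_stab (u : D) : phi (M + M)%N u = 0%R -> phi M u = 0%R.
  move=> phi2; have : iter K (R a) (dapp u a) = a.
    by apply: KP; exists (M + M)%N; rewrite (iter_R_dapp a) -/(phi _ _) phi2.
  rewrite (iter_R_dapp a) -/(phi _ _) => /(stab_conj a) fix_K.
  by rewrite /M -add1n phiD phi1 fix_K subrr.
have conjV_phi k u : phi k (conjV a u) = conjV a (phi k u).
  by apply: (can_inj (@conjK _ Qm a)); rewrite /phi -pact_comm /= !conjVK.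
have ker_stable : stable_subgroup (conj a) (conjV a) (fun u => phi M u = 0%R).
  split=> [|u v u0 v0|u u0|u u0]; first exact: phi0.
  - by rewrite /phi pactBr -!/(phi _ _) u0 v0 subrr.
  - by rewrite /phi pact_comm -/(phi _ _) u0 raddf0.
  - by rewrite conjV_phi u0 raddf0.
have im_stable :
    stable_subgroup (conj a) (conjV a) (fun u => exists v, phi M v = u).
  split=> [|u v [u' <-] [v' <-]|u [u' <-]|u [u' <-]].
  - by exists 0%R.
  - by exists (u' - v')%R; rewrite /phi pactBr.
  - by exists (conj a u'); rewrite /phi pact_comm.
  - by exists (conjV a u'); rewrite conjV_phi.
have [im0|im_neq0] := pselect (forall u, phi M u = 0%R).
  (* The first step moves [x] into the orbit of [y], and the other [M] steps apply (1 - f)^M. *)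
  exists M.+1 => // x y; rewrite iterSr.
  have -> : R y x = dapp (disL Qm x y) y by rewrite dapp_disL ldivxx.
  by rewrite (iter_R_dapp a) -/(phi _ _) im0.
have [u1 u1_ker u1a] : exists2 u, phi M u = 0%R & dapp u a = b.
  apply: (orbit_min ker_stable).
  have /(same_orbitP Qm)[u uc] := cd_orbit; exists u; last first.
    by move=> u0; apply: cd; rewrite -uc u0.
  rewrite /M -addn1 phiD phi1 ((L_eq_conj a u c).1 _) ?subrr ?phi0//.
  by rewrite uc; apply: fsym.
have [u2 [v vu2] u2a] : exists2 u, exists v, phi M v = u & dapp u a = b.
  apply: (orbit_min im_stable).
  have /existsNP[u u_neq0] := im_neq0.
  by exists (phi M u) => //; exists u.
(* [u1] and [u2] agree at [a], so their difference fixes [b] and 1 - f kills it. Hence (1 - f)^M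
   kills [u2] as well, and [phi_stab] gives u2 = 0. *)
have u12 : phi 1 u2 = phi 1 u1.
  have : conj a (u2 - u1)%R = (u2 - u1)%R.
    by apply: (@stab_conj _ _ _ _ b); rewrite dappD -{1}u1a dappNK.
  rewrite conjB !phi1 => fixB; apply: (addIr (conj a u2)).
  by rewrite subrK -addrA [(- _ + _)%R]addrC fixB addrC subrK.
case: ab; rewrite -u2a -vu2 phi_stab// phiD vu2.
by rewrite /M -addn1 phiD u12 -phiD addn1.
Qed.

Lemma connected_not_reductive : connected Q -> ~ reductive Q.
Proof.
move=> Qc [m _ Qred].
(* By connectedness c = w d, so each generator L_c L_d^-1 is (1 - f)(w). *)
have surj (v : D) : exists u, (u - conj a u)%R = v.
  elim/dis_ind: v => [|c d v [u <-]]; first by exists 0%R; rewrite raddf0 subrr.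
  have /(same_orbitP Qm)[w <-] := Qc d c.
  by exists (w + u)%R; rewrite (disL_dapp a) conjD opprD addrACA.
have surj_iter k (v : D) : exists u, pact (conj a) ((1 - 'X) ^+ k)%R u = v.
  elim: k v => [|k IHk] v; first by exists v; rewrite expr0 pact1.
  have [u <-] := surj v; have [w <-] := IHk u.
  by exists w; rewrite exprS pactM pact1BX.
have /(same_orbitP Qm)[v va] := Qc a b; apply: ab.
by have [u uv] := surj_iter m v; rewrite -va -uv -(iter_R_dapp a) Qred.
Qed.

End SubdirectlyIrreducible.

Lemma connected_alexander (e : Q) : connected Q -> is_alexander Q.
Proof.
move=> Qc; have /choice[h hP] x : exists u : D, dapp u e = x.
  by apply/same_orbitP; apply: Qc.
(* In a transitive abelian group, a displacement is determined by its value at [e]. *)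
have dapp_inj (u v : D) : dapp u e = dapp v e -> u = v.
  by move=> uve; apply: dis_eq => x; rewrite -(hP x) !(dapp_comm _ (h x)) uve.
have h_op x y : h (x * y) =
    alexander_op (conj e : {additive D -> D}) (h x) (h y).
  apply: dapp_inj; rewrite hP -[in LHS](hP x) -[in LHS](hP y).
  by rewrite (dapp_op2 e) qopxx.
exists D, (conj e), (conjV e), (@conjK _ Qm e), (@conjVK _ Qm e), h; split=> //.
  exists (fun u => dapp u e) => // u; apply: dapp_inj; exact: hP.
move=> x y.
apply: (@qop_inj (alexander (@conjK _ Qm e) (@conjVK _ Qm e)) (h x)).
by rewrite qldivK -[LHS]h_op qldivK.
Qed.

End MedialQuandle.

Lemma latin_injective (Q : quandle) (c : Q) : latin Q -> injective (R c).
Proof. by move=> /(_ c)/bij_inj. Qed.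

Lemma latin_connected (Q : quandle) : latin Q -> connected Q.
Proof.
move=> Qlat x y; have [g _ gK] := Qlat x.
by exists (L (g y)); [exact: lmlt_L|apply: gK].
Qed.

Lemma right_cancellative_not_quasi_reductive (Q : quandle) :
  (forall c : Q, injective (R c)) -> ~ quasi_reductive Q.
Proof. by move=> Rinj [c [d [cd _ /(_ c)/Rinj]]]. Qed.

Theorem theorem9p1 (Q : quandle) (Qmedial : medial Q)
    (Qsi : subdirectly_irreducible Q) :
  [/\ [\/ latin Q,
          infinite_connected_quasi_reductive Q,
          reductive Q
        | infinite_nonconnected_quasi_reductive_nonreductive Q],
      pairwise_exclusive
        (latin Q)
        (infinite_connected_quasi_reductive Q)
        (reductive Q)
        (infinite_nonconnected_quasi_reductive_nonreductive Q),
      latin Q -> is_alexander Q /\ cancellative Q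
    & infinite_connected_quasi_reductive Q ->
        is_alexander Q /\ ~ cancellative Q].
Proof.
have [a [b [ab ab_min]]] := subdirectly_irreducible_pair Qsi.
have lat_conn := @latin_connected Q.
have conn_red := connected_not_reductive Qmedial ab.
have lat_QR : latin Q -> ~ quasi_reductive Q.
  move=> Qlat; apply: right_cancellative_not_quasi_reductive => c.
  exact: latin_injective.
split.
(* Outside the reductive class, [Q] is latin unless quasi-reductive, and then infinite;
   connectedness separates the two remaining classes. *)
- have [Qred|Qnred] := pselect (reductive Q); first by apply: Or43.
  have [QR|nQR] := pselect (quasi_reductive Q); last first.
    have [|//] := not_quasi_reductive_latin Qmedial ab ab_min nQR.
    exact: Or41.
  have Qinf : infinite Q.
    by move=> /(finite_quasi_reductive_reductive Qmedial ab ab_min)/(_ QR).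
  by have [Qc|Qnc] := pselect (connected Q); [apply: Or42|apply: Or44].
- split; split.
  + by move=> [/lat_QR nQR [_ _ /nQR]].
  + by move=> [/lat_conn/conn_red].
  + by move=> [/lat_QR nQR [_ _ /nQR]].
  + by move=> [[/conn_red]].
  + by move=> [[Qc _ _] [/(_ Qc)]].
  + by move=> [Qred [_ _ _ /(_ Qred)]].
- move=> Qlat; split.
    exact: (connected_alexander Qmedial a (lat_conn Qlat)).
  by split=> c; [exact: qop_inj|exact: latin_injective].
- move=> [Qc _ QR]; split; first exact: (connected_alexander Qmedial a Qc).
  by move=> [_ /right_cancellative_not_quasi_reductive].
Qed.
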